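(* Let $P$ be a nondeterministic probabilistic program with CFG $(V_p,V_r,L,\to)$, linear invariant $I$, and a PUCS $h$ with respect to $I$ that is nonnegative, i.e. $h(\ell,\mathbf{w})\ge 0$ for all labels $\ell$ and all $\mathbf{w}\in I(\ell)$. If all step-wise costs in $P$ are nonnegative, i.e. $R_\ell(\mathbf{w})\ge 0$ for every tick label $\ell$ and every $\mathbf{w}\in I(\ell)$, then $\mathrm{supval}(\mathbf{v})\le h(\ell_{in},\mathbf{v})$ for all initial valuations $\mathbf{v}\in I(\ell_{in})$. (No bounded update or concentration assumption is required.)
   Context: Program model. A program is given by its control-flow graph (CFG) $(V_p,V_r,L,\to)$: $V_p$ is a finite set of real-valued program variables, $V_r$ a finite set of sampling variables, each $r\in V_r$ having a fixed probability distribution on $\mathbb{R}$ (assumed such that all expectations appearing in the pre-expectation below are finite); a valuation over a set $V$ is a map $V\to\mathbb{R}$, and $\mathrm{Val}(V)$ is the set of valuations. The finite label set $L$ is partitioned into assignment labels $L_a$, branching labels $L_b$, probabilistic labels $L_p$, nondeterministic labels $L_{nd}$, tick labels $L_t$, and a terminal label $\ell_{out}$; $\ell_{in}$ is the initial label. An assignment label $\ell$ has a unique successor $\ell'$ and a polynomial update function $F_\ell:\mathrm{Val}(V_p)\times\mathrm{Val}(V_r)\to\mathrm{Val}(V_p)$; a branching label has a condition $\phi$ over $V_p$ with successor $\ell_1$ if $\phi$ holds and $\ell_2$ otherwise; a probabilistic label has $p\in[0,1]$ and goes to successor $\ell_1$ with probability $p$ and $\ell_2$ with probability $1-p$; a nondeterministic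 label has two successors; a tick label has a unique successor $\ell'$ and a polynomial cost function $R_\ell:\mathrm{Val}(V_p)\to\mathbb{R}$. Only assignments change the valuation. A configuration is a pair $(\ell,\mathbf{v})$; a run is an infinite sequence of configurations. A scheduler maps every finite run ending in a configuration with a nondeterministic label to one of that label's successors. Given a scheduler $\sigma$ and initial valuation $\mathbf{v}$, runs start at $(\ell_{in},\mathbf{v})$ and evolve as follows: at $\ell_{out}$ the run stays forever; at an assignment label a fresh valuation $\mathbf{u}$ of $V_r$ is sampled independently (each $r$ from its distribution) and the next configuration is $(\ell',F_\ell(\mathbf{v},\mathbf{u}))$; branching/probabilistic/nondeterministic/tick labels move to the successor determined by the condition/coin/scheduler/unique successor without changing the valuation. This yields a probability measure $\mathbb{P}^\sigma_{\mathbf{v}}$ on runs with expectation $\mathbb{E}^\sigma_{\mathbf{v}}$. For a run $\{(\ell_n,\mathbf{v}_n)\}_n$, the step cost is $C_m=R_{\ell_m}(\mathbf{v}_m)$ if $\ell_m\in L_t$ and $C_m=0$ otherwise; $C_\infty=\sum_{m=0}^\infty C_m$; and $\mathrm{supval}(\mathbf{v})=\sup_\sigma\mathbb{E}^\sigma_{\mathbf{v}}(C_\infty)$. Invariant. A linear invariant is a map $I$ assigning to each label a finite union of polyhedra $I(\ell)\subseteq\mathrm{Val}(V_p)$ such that for every $\mathbf{v}\in I(\ell_{in})$, every configuration $(\ell,\mathbf{w})$ reachable from $(\ell_{in},\mathbf{v})$ satisfies $\mathbf{w}\in I(\ell)$. Pre-expectation. For $h:L\times\mathrm{Val}(V_p)\to\mathbb{R}$,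 $\mathrm{pre}_h(\ell,\mathbf{v})$ is: $h(\ell,\mathbf{v})$ if $\ell=\ell_{out}$; $\mathbb{E}_{\mathbf{u}}[h(\ell',F_\ell(\mathbf{v},\mathbf{u}))]$ if $\ell\in L_a$ (with $\mathbf{u}$ distributed as the sampling variables); $\mathbf{1}_{\mathbf{v}\models\phi}h(\ell_1,\mathbf{v})+\mathbf{1}_{\mathbf{v}\not\models\phi}h(\ell_2,\mathbf{v})$ if $\ell\in L_b$; $p\,h(\ell_1,\mathbf{v})+(1-p)h(\ell_2,\mathbf{v})$ if $\ell\in L_p$; $R_\ell(\mathbf{v})+h(\ell',\mathbf{v})$ if $\ell\in L_t$; the maximum of $h(\ell'',\mathbf{v})$ over the successors $\ell''$ of $\ell$ if $\ell\in L_{nd}$. PUCS. A polynomial upper cost supermartingale (PUCS) of degree $d$ w.r.t. $I$ is $h:L\times\mathrm{Val}(V_p)\to\mathbb{R}$ such that (C1) each $h(\ell,\cdot)$ is a polynomial of degree at most $d$ in the program variables; (C2) $h(\ell_{out},\mathbf{v})=0$ for all $\mathbf{v}$; (C3) $\mathrm{pre}_h(\ell,\mathbf{v})\le h(\ell,\mathbf{v})$ for all $\ell\ne\ell_{out}$ and all $\mathbf{v}\in I(\ell)$. *)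

(* Defs.v *)
From Stdlib Require List.
From HB Require Import structures.
From mathcomp Require Import all_boot all_order all_algebra.
From mathcomp Require Import all_classical all_reals all_analysis.

Set Implicit Arguments.
Unset Strict Implicit.
Unset Printing Implicit Defensive.

Import Order.TTheory GRing.Theory Num.Theory.
Local Open Scope ring_scope.
Local Open Scope classical_set_scope.

Inductive pexpr (R : Type) (n : nat) : Type :=
| PConst of R
| PVar of 'I_n
| PAdd of pexpr R n & pexpr R n
| PMul of pexpr R n & pexpr R n.

Arguments PConst {R n}.
Arguments PVar {R n}.
Arguments PAdd {R n}.
Arguments PMul {R n}.

Fixpoint peval (R : realType) (n : nat) (e : pexpr R n) (x : 'I_n -> R) : R :=
  match e with
  | PConst c => c
  | PVar i => x i
  | PAdd e1 e2 => peval e1 x + peval e2 x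
  | PMul e1 e2 => peval e1 x * peval e2 x
  end.

(* syntactic degree: an upper bound of the degree of the represented polynomial,
   and equal to it for an expression in expanded monomial form *)
Fixpoint pdeg (R : Type) (n : nat) (e : pexpr R n) : nat :=
  match e with
  | PConst _ => 0
  | PVar _ => 1
  | PAdd e1 e2 => maxn (pdeg e1) (pdeg e2)
  | PMul e1 e2 => (pdeg e1 + pdeg e2)%N
  end.

Definition is_poly_deg (R : realType) (n d : nat) (f : ('I_n -> R) -> R) : Prop :=
  exists e : pexpr R n, (pdeg e <= d)%N /\ forall x, f x = peval e x.

Inductive cond (R : Type) (n : nat) : Type :=
| CLe of pexpr R n & pexpr R n
| CLt of pexpr R n & pexpr R n
| CNot of cond R n
| CAnd of cond R n & cond R n
| COr of cond R n & cond R n.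

Fixpoint ceval (R : realType) (n : nat) (c : cond R n) (x : 'I_n -> R) : bool :=
  match c with
  | CLe p q => peval p x <= peval q x
  | CLt p q => peval p x < peval q x
  | CNot c1 => ~~ ceval c1 x
  | CAnd c1 c2 => ceval c1 x && ceval c2 x
  | COr c1 c2 => ceval c1 x || ceval c2 x
  end.

(* Control-flow graphs.  np = |V_p|, nr = |V_r|.                              *)
Inductive lkind (R : Type) (L : Type) (np nr : nat) : Type :=
| KAssign of ('I_np -> pexpr R (np + nr)%N) & L
| KBranch of cond R np & L & L                 (* condition phi, l1 (phi), l2 (not phi) *)
| KProb of R & L & L                           (* p, l1 (prob p), l2 (prob 1-p) *)
| KNondet of L & L
| KTick of pexpr R np & L
| KOut.

Arguments KAssign {R L np nr}.
Arguments KBranch {R L np nr}.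
Arguments KProb {R L np nr}.
Arguments KNondet {R L np nr}.
Arguments KTick {R L np nr}.
Arguments KOut {R L np nr}.
Arguments CLe {R n}.
Arguments CLt {R n}.
Arguments CNot {R n}.
Arguments CAnd {R n}.
Arguments COr {R n}.

Record cfg (R : realType) (np nr : nat) := CFG {
  label : finType;
  kind : label -> lkind R label np nr;
  l_in : label;
  l_out : label;
  kind_out : forall l, kind l = KOut <-> l = l_out;
  kind_prob : forall l p l1 l2, kind l = KProb p l1 l2 -> 0 <= p <= 1
}.

Section Semantics.
Context (R : realType) (np nr : nat) (P : cfg R np nr).

Local Notation L := (label P).
Local Notation Val := ('I_np -> R).
Local Notation config := (L * Val)%type.

Definition env (v : Val) (u : nr.-tuple R) : 'I_(np + nr)%N -> R :=
  fun i => match fintype.split i with inl a => v a | inr b => tnth u b end.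

Definition upd (F : 'I_np -> pexpr R (np + nr)%N) (v : Val) (u : nr.-tuple R) : Val :=
  fun i => peval (F i) (env v u).

(* the joint law mu of the sampling variables is the product of the laws mur j
   (independent sampling) *)
Definition product_of (mu : probability (nr.-tuple R) R)
    (mur : 'I_nr -> probability R R) : Prop :=
  forall B : 'I_nr -> set R, (forall j, measurable (B j)) ->
    mu [set u | forall j, B j (tnth u j)] = (\prod_(j < nr) mur j (B j))%E.

Definition in_support (m : probability R R) (x : R) : Prop :=
  forall e : R, 0 < e -> (0 < m [set y : R | (`|y - x| < e)%R])%E.

Definition step (mur : 'I_nr -> probability R R) (c c' : config) : Prop :=
  match kind c.1 with
  | KAssign F l' => exists u : nr.-tuple R,
      (forall j, in_support (mur j) (tnth u j)) /\ c' = (l', upd F c.2 u)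
  | KBranch phi l1 l2 => c' = (if ceval phi c.2 then l1 else l2, c.2)
  | KProb p l1 l2 => (0 < p /\ c' = (l1, c.2)) \/ (p < 1 /\ c' = (l2, c.2))
  | KNondet l1 l2 => c' = (l1, c.2) \/ c' = (l2, c.2)
  | KTick _ l' => c' = (l', c.2)
  | KOut => c' = c
  end.

Inductive reachable (mur : 'I_nr -> probability R R) (c : config) : config -> Prop :=
| reach_refl : reachable mur c c
| reach_step c1 c2 : reachable mur c c1 -> step mur c1 c2 -> reachable mur c c2.

Definition lin_sat (ab : Val * R) (v : Val) : Prop :=
  \sum_(i < np) ab.1 i * v i <= ab.2.

Definition polyhedron_of (cs : seq (Val * R)) : set Val :=
  [set v | forall ab, Stdlib.Lists.List.In ab cs -> lin_sat ab v].

Definition finite_union_of_polyhedra (S : set Val) : Prop :=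
  exists Ps : seq (seq (Val * R)),
    S = [set v | exists cs, Stdlib.Lists.List.In cs Ps /\ polyhedron_of cs v].

Definition linear_invariant (mur : 'I_nr -> probability R R) (I : L -> set Val) : Prop :=
  (forall l, finite_union_of_polyhedra (I l)) /\
  (forall v, I (l_in P) v -> forall c, reachable mur (l_in P, v) c -> I c.1 c.2).

Definition pre (mu : probability (nr.-tuple R) R) (h : L -> Val -> R)
    (l : L) (v : Val) : \bar R :=
  match kind l with
  | KAssign F l' => (\int[mu]_u (h l' (upd F v u))%:E)%E
  | KBranch phi l1 l2 => (if ceval phi v then h l1 v else h l2 v)%:E
  | KProb p l1 l2 => (p * h l1 v + (1 - p) * h l2 v)%:E
  | KNondet l1 l2 => (Num.max (h l1 v) (h l2 v))%:E
  | KTick c l' => (peval c v + h l' v)%:E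
  | KOut => (h l v)%:E
  end.

(* standing assumption: the expectations in the pre-expectation are finite *)
Definition pre_finite (mu : probability (nr.-tuple R) R) (I : L -> set Val)
    (h : L -> Val -> R) : Prop :=
  forall l F l', kind l = KAssign F l' -> forall v, I l v ->
    mu.-integrable [set: nr.-tuple R] (fun u => (h l' (upd F v u))%:E).

Definition PUCS (mu : probability (nr.-tuple R) R) (I : L -> set Val) (d : nat)
    (h : L -> Val -> R) : Prop :=
  [/\ (forall l, is_poly_deg d (h l)),
      (forall v, h (l_out P) v = 0) &
      (forall l, l <> l_out P -> forall v, I l v -> (pre mu h l v <= (h l v)%:E)%E)].

(* Runs and their probability measure P^sigma_v, given as a process          *)
(* (lab n, val n)_n on a probability space whose law is the run measure.     *)

Definition box_in (A : set L * ('I_np -> set R)) (c : config) : Prop :=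
  A.1 c.1 /\ forall j, A.2 j (c.2 j).

Definition ind (A : set L * ('I_np -> set R)) (c : config) : \bar R :=
  (if `[< box_in A c >] then 1 else 0)%:E.

(* one-step transition kernel, b = scheduler choice (true: first successor) *)
Definition kernel (mu : probability (nr.-tuple R) R) (l : L) (w : Val) (b : bool)
    (A : set L * ('I_np -> set R)) : \bar R :=
  match kind l with
  | KAssign F l' => mu [set u | box_in A (l', upd F w u)]
  | KBranch phi l1 l2 => ind A (if ceval phi w then l1 else l2, w)
  | KProb p l1 l2 => (p%:E * ind A (l1, w) + (1 - p)%:E * ind A (l2, w))%E
  | KNondet l1 l2 => ind A (if b then l1 else l2, w)
  | KTick _ l' => ind A (l', w)
  | KOut => ind A (l, w)
  end.

Definition hist (T : Type) (lab : nat -> T -> L) (val : nat -> T -> Val)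
    (n : nat) (om : T) : seq config :=
  [seq (lab i om, val i om) | i <- iota 0 n.+1].

(* (lab, val) on (Omega, Pr) is distributed according to P^sigma_v *)
Definition run_process (mu : probability (nr.-tuple R) R)
    (sigma : seq config -> bool) (v : Val)
    (d : measure_display) (Omega : measurableType d) (Pr : probability Omega R)
    (lab : nat -> Omega -> L) (val : nat -> Omega -> Val) : Prop :=
  [/\ (forall n l, measurable [set om | lab n om = l]),
      (forall n j, measurable_fun [set: Omega] (fun om => val n om j)),
      (forall n, measurable [set om | sigma (hist lab val n om)]),
      (forall A : set L * ('I_np -> set R), (forall j, measurable (A.2 j)) ->
         Pr [set om | box_in A (lab 0%N om, val 0%N om)] = ind A (l_in P, v)) &
      (forall (n : nat) (As : nat -> set L * ('I_np -> set R)),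
         (forall i j, measurable ((As i).2 j)) ->
         Pr [set om | forall i, (i <= n.+1)%N -> box_in (As i) (lab i om, val i om)] =
         (\int[Pr]_om
            ((if `[< forall i, (i <= n)%N -> box_in (As i) (lab i om, val i om) >]
              then 1 else 0)%:E
             * kernel mu (lab n om) (val n om) (sigma (hist lab val n om)) (As n.+1)))%E)].

Definition step_cost (l : L) (w : Val) : R :=
  match kind l with KTick c _ => peval c w | _ => 0 end.

Definition total_cost (T : Type) (lab : nat -> T -> L) (val : nat -> T -> Val)
    (om : T) : \bar R :=
  (\sum_(m <oo) (step_cost (lab m om) (val m om))%:E)%E.

End Semantics.

(* Main.v *)
(* Scheduler choices aside, one step of the program is a deterministic function
   [next_state] of a sample of the sampling variables and of an independent
   uniform variable.  Let [safe] be the set of configurations in [I] from which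
   the process almost surely stays in [I]: it is measurable, almost surely closed
   under steps, and contains every reachable configuration because the support of
   a product law has full mass.  The function [potential] equal to [h] on [safe]
   and to [+oo] elsewhere is nonnegative and satisfies
   E[potential (next c)] + cost^+ c <= potential c at every configuration, so the
   expected positive costs telescope to at most h(l_in, v) by monotone
   convergence alone.  As the expected potential stays finite, the run is almost
   surely safe, where costs equal their positive parts. *)
Require Import Defs.
From HB Require Import structures.
From mathcomp Require Import all_boot all_order all_algebra.
From mathcomp Require Import all_classical all_reals all_analysis.
From mathcomp Require Import measurable_realfun.
Import Order.TTheory GRing.Theory Num.Theory.
Local Open Scope ring_scope.
Local Open Scope classical_set_scope.
Set Implicit Arguments.
Unset Strict Implicit.
Unset Printing Implicit Defensive.

(** * The measurable space of configurations *)

Definition state (R : realType) (np nr : nat) (P : cfg R np nr) : Type :=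
  (label P * ('I_np -> R))%type.

HB.instance Definition _ (R : realType) (np nr : nat) (P : cfg R np nr) :=
  Choice.on (state P).
HB.instance Definition _ (R : realType) (np nr : nat) (P : cfg R np nr) :=
  isPointed.Build (state P) (l_in P, fun=> 0).

(** Boxes are the events whose probabilities [run_process] prescribes. Generating the sigma-algebra
    from them lets the law of a configuration be read off from that data. *)
Definition boxes (R : realType) (np nr : nat) (P : cfg R np nr) :
    set (set (state P)) :=
  [set B | exists2 A : set (label P) * ('I_np -> set R),
     (forall j, measurable (A.2 j)) & B = [set c : state P | box_in A c]].

Notation mstate P := (g_sigma_algebraType (@boxes _ _ _ P)).

Section state_measurability.
Context (R : realType) (np nr : nat) (P : cfg R np nr).
Local Notation L := (label P).

Lemma measurable_box (A : set L * ('I_np -> set R)) :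
  (forall j, measurable (A.2 j)) -> measurable [set c : mstate P | box_in A c].
Proof. by move=> mA; apply: sub_sigma_algebra; exists A. Qed.

Lemma measurable_label (l : L) : measurable [set c : mstate P | c.1 = l].
Proof.
have -> : [set c : mstate P | c.1 = l] =
          [set c : mstate P | box_in ([set l], fun=> setT) c].
  by apply/seteqP; split=> c /=; [move=> cl; split|case].
by apply: measurable_box => j /=.
Qed.

Lemma measurable_coord (j : 'I_np) :
  measurable_fun [set: mstate P] (fun c : mstate P => c.2 j).
Proof.
move=> _ Y mY; rewrite setTI.
have -> : (fun c : mstate P => c.2 j) @^-1` Y =
    [set c : mstate P | box_in (setT, fun i => if i == j then Y else setT) c].
  apply/seteqP; split=> c /=.
    by move=> Yc; split=> // i /=; case: eqP => // ->.
  by case=> _ /(_ j) /=; rewrite eqxx.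
by apply: measurable_box => i /=; case: ifP.
Qed.

(** Together with [boxesT], this makes the boxes a pi-system containing the whole space, as needed
    for uniqueness of measures. *)
Lemma setI_closed_boxes : setI_closed (@boxes _ _ _ P).
Proof.
move=> _ _ [A mA ->] [B mB ->].
exists (A.1 `&` B.1, fun j => A.2 j `&` B.2 j) => /=.
  by move=> j; exact: measurableI.
apply/seteqP; split=> c /=.
  by move=> [[A1 A2] [B1 B2]]; split=> //= j; split.
by move=> [[A1 B1] AB]; split; split=> // j; have [] := AB j.
Qed.

Lemma boxesT : boxes [set: state P].
Proof.
exists (setT, fun=> setT) => [j //=|].
by apply/seteqP; split=> c.
Qed.

Section maps.
Context (d : measure_display) (T : measurableType d).

(** The preimage of a box is a finite union of label events intersected with finitely many
    coordinate preimages. *)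
Lemma measurable_fun_state (f : T -> mstate P) :
  (forall l, measurable [set t | (f t).1 = l]) ->
  (forall j, measurable_fun [set: T] (fun t => (f t).2 j)) ->
  measurable_fun [set: T] f.
Proof.
move=> mf1 mf2; apply: (@measurability _ _ T (mstate P) setT f (@boxes _ _ _ P)) => //.
move=> _ [_ [A mA ->] <-]; rewrite setTI.
have -> : f @^-1` [set c : state P | box_in A c] =
    \bigcup_(l in A.1) [set t | (f t).1 = l] `&`
    \bigcap_(j in [set: 'I_np]) ((fun t => (f t).2 j) @^-1` A.2 j).
  apply/seteqP; split=> t /=.
    by move=> [A1 A2]; split; [exists (f t).1|move=> j _; exact: A2].
  by move=> [[l Al /= fl] A2]; split=> [|j]; [rewrite fl|exact: A2].
apply: measurableI.
  by apply: fin_bigcup_measurable => // l _; exact: mf1.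
apply: fin_bigcap_measurable => // j _.
by rewrite -[X in measurable X]setTI; exact: mf2.
Qed.

(** Used to treat functions defined by cases on the label one label at a time: preimages split along
    finitely many label events. *)
Lemma measurable_fun_finite_case (d' : measure_display) (T' : measurableType d')
    (K : finType) (lab : T -> K) (F : K -> T -> T') :
  (forall l, measurable [set t | lab t = l]) ->
  (forall l, measurable_fun [set: T] (F l)) ->
  measurable_fun [set: T] (fun t => F (lab t) t).
Proof.
move=> mlab mF _ Y mY; rewrite setTI.
have -> : (fun t => F (lab t) t) @^-1` Y =
    \bigcup_(l in [set: K]) ([set t | lab t = l] `&` F l @^-1` Y).
  apply/seteqP; split=> t /=; first by move=> Ft; exists (lab t).
  by move=> [l _ [/= <-]].
apply: fin_bigcup_measurable => // l _; apply: measurableI => //.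
by rewrite -[X in measurable X]setTI; exact: mF.
Qed.

Lemma measurable_peval (n : nat) (e : pexpr R n) (x : T -> 'I_n -> R) :
  (forall i, measurable_fun [set: T] (x ^~ i)) ->
  measurable_fun [set: T] (fun t => peval e (x t)).
Proof.
move=> mx; elim: e => [c|i|e1 IH1 e2 IH2|e1 IH1 e2 IH2] /=.
- exact: measurable_cst.
- exact: mx.
- exact: measurable_funD.
- exact: measurable_funM.
Qed.

Lemma measurable_ceval (n : nat) (c : cond R n) (x : T -> 'I_n -> R) :
  (forall i, measurable_fun [set: T] (x ^~ i)) ->
  measurable_fun [set: T] (fun t => ceval c (x t)).
Proof.
move=> mx; elim: c => [p q|p q|c IH|c1 IH1 c2 IH2|c1 IH1 c2 IH2] /=.
- by apply: measurable_fun_ler; exact: measurable_peval.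
- by apply: measurable_fun_ltr; exact: measurable_peval.
- exact: measurable_neg.
- exact: measurable_and.
- exact: measurable_or.
Qed.

End maps.

End state_measurability.

(** * Full mass of the support, for one law and for a product law *)

Section support.
Context (R : realType).

(** A point outside the support lies in an open interval with rational endpoints and mass zero, and
    there are only countably many such intervals. *)
Lemma ae_in_support (m : probability R R) : {ae m, forall x, in_support m x}.
Proof.
pose itv (q : rat * rat) : set R := `]ratr q.1, ratr q.2[%classic.
(* Codes that decode to no pair, and intervals of positive mass, are sent to the empty set, so that
   every [F k] is null. *)
pose F k : set R := if unpickle k is Some q then
  (if m (itv q) == 0%E then itv q else set0) else set0.
apply: (@negligibleS _ _ _ m (\bigcup_k F k)); last first.
  apply: negligible_bigcup => k; rewrite /F.
  case: unpickle => [q|]; last exact: negligible_set0.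
  case: ifPn => [/eqP q0|_]; last exact: negligible_set0.
  by apply/negligibleP => //; exact: measurable_itv.
move=> x /= /existsNP[e /not_implyP[e0 /negP]].
rewrite -leNgt => mxe.
have [q1 q1x] : {q : rat | x - e < ratr q < x}.
  by apply/cid/rat_in_itvoo; rewrite ltrBlDr ltrDl.
have [q2 xq2] : {q : rat | x < ratr q < x + e}.
  by apply/cid/rat_in_itvoo; rewrite ltrDl.
move: q1x xq2 => /andP[xq1 q1x] /andP[xq2 q2x].
have [k kE] : exists k, unpickle k = Some (q1, q2).
  by exists (pickle (q1, q2)); rewrite pickleK.
exists k; first exact: I.
rewrite /F kE.
have -> : m (itv (q1, q2)) == 0%E.
  rewrite eq_le measure_ge0 andbT (le_trans _ mxe)// le_measure ?inE//.
  - exact: measurable_itv.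
  - have -> : [set y : R | `|y - x| < e] = `]x - e, x + e[%classic.
      by apply/seteqP; split=> y; rewrite /= in_itv/= ltr_distl.
    exact: measurable_itv.
  - move=> y; rewrite /itv /= in_itv /= ltr_distl => /andP[q1y yq2].
    by rewrite (lt_trans xq1)//= (lt_trans yq2).
by rewrite /itv /= in_itv /= q1x.
Qed.

Lemma ae_product_support (nr : nat) (mu : probability (nr.-tuple R) R)
    (mur : 'I_nr -> probability R R) : product_of mu mur ->
  {ae mu, forall u, forall j, in_support (mur j) (tnth u j)}.
Proof.
move=> Hmu.
have /choice[N HN] : forall j, exists N, [/\ measurable N, mur j N = 0%E &
    ~` [set x | in_support (mur j) x] `<=` N].
  by move=> j; have [N HN] := ae_in_support (mur j); exists N.
have mN j : measurable (~` N j) by have [? _ _] := HN j; exact: measurableC.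
have mB : measurable [set u : nr.-tuple R | forall j, (~` N j) (tnth u j)].
  have -> : [set u : nr.-tuple R | forall j, (~` N j) (tnth u j)] =
      \bigcap_(j in [set: 'I_nr]) ((fun u => tnth u j) @^-1` (~` N j)).
    by apply/seteqP; split=> u /= Nu j *; exact: Nu.
  apply: fin_bigcap_measurable => // j _; rewrite -[X in measurable X]setTI.
  by apply: measurable_tnth => //; exact: mN.
exists (~` [set u : nr.-tuple R | forall j, (~` N j) (tnth u j)]); split.
- exact: measurableC.
- rewrite probability_setC// (Hmu (fun j => ~` N j))//.
  rewrite big1 ?subee// => j _; have [mNj Nj0 _] := HN j.
  by rewrite probability_setC// Nj0 sube0.
- apply: subsetC => u Nu j; have [_ _ sN] := HN j.
  by apply: contrapT => /sN; exact: Nu.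
Qed.

End support.

(** * The uniform variable that simulates coin flips *)

Section noise.
Context (R : realType).

Definition uniform01 : probability (measurableTypeR R) R := uniform_prob (@ltr01 R).

Lemma uniform01_lt (p : R) : 0 <= p <= 1 -> uniform01 [set x : R | x < p] = p%:E.
Proof.
move=> /andP[p0 p1]; rewrite /uniform01 /= /uniform_prob integral_uniform_pdf.
have -> : [set x : R | x < p] `&` `[0, 1]%classic = `[0, p[%classic :> set R.
  apply/seteqP; split=> x /=; rewrite !in_itv/=.
    by move=> [-> /andP[-> _]].
  by move=> /andP[x0 xp]; split=> //; rewrite x0 (le_trans (ltW xp)).
rewrite (eq_integral (cst 1%E)); last first.
  move=> x; rewrite inE /= in_itv /= => /andP[x0 xp].
  by rewrite /uniform_pdf x0 (le_trans (ltW xp))//= subr0 invr1.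
rewrite integral_cst//= mul1e lebesgue_measure_itv/= lte_fin.
case: ltP => [_|p_le0]; first by rewrite sube0.
by congr (_%:E); apply/le_anti/andP; split.
Qed.

(** The half-open range matches the side conditions of [step]: given [0 <= x < 1], the test [x < p]
    succeeds only if [0 < p] and fails only if [p < 1]. *)
Lemma ae_uniform01 : {ae uniform01, forall x, 0 <= x < 1}.
Proof.
pose A (p : R) : set (measurableTypeR R) := [set x : R | x < p].
have mA p : measurable (A p).
  by rewrite -[X in measurable X]setTI; exact: measurable_fun_ltr.
have uA p : 0 <= p <= 1 -> uniform01 (A p) = p%:E by exact: uniform01_lt.
apply: (@negligibleS _ _ _ uniform01 (A 0 `|` ~` A 1)).
  by move=> x /= /negP; rewrite negb_and -ltNge => /orP[?|/negP ?]; [left|right].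
apply: negligibleU; apply/negligibleP; [exact: mA| | |].
- by apply: uA; rewrite lexx ler01.
- by apply: measurableC; exact: mA.
- by rewrite [LHS](@probability_setC _ _ _ uniform01)// uA ?lexx ?ler01// subee.
Qed.

End noise.

(** * Marginals of a product of two probabilities *)

Section product_probability.
Context (R : realType) (d1 d2 : measure_display).
Context (T1 : measurableType d1) (T2 : measurableType d2).
Context (m1 : probability T1 R) (m2 : probability T2 R).
Local Notation m := (m1 \x m2)%E.

Lemma product_prob_fst (S : set T1) : measurable S ->
  m [set y | S y.1] = m1 S.
Proof.
move=> mS; have -> : [set y : T1 * T2 | S y.1] = S `*` setT.
  by apply/seteqP; split=> y /=; [move=> ?; split|case].
by rewrite product_measure1E// [X in (_ * X)%E]probability_setT mule1.
Qed.

Lemma product_prob_snd (S : set T2) : measurable S ->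
  m [set y | S y.2] = m2 S.
Proof.
move=> mS; have -> : [set y : T1 * T2 | S y.2] = setT `*` S.
  by apply/seteqP; split=> y /=; [move=> ?; split|case].
by rewrite product_measure1E// [X in (X * _)%E]probability_setT mul1e.
Qed.

Lemma ae_product_fst (Q : T1 -> Prop) :
  {ae m1, forall u, Q u} -> {ae m, forall y, Q y.1}.
Proof.
move=> [N [mN N0 QN]]; exists [set y | N y.1]; split.
- by rewrite -[X in measurable X]setTI; exact: measurable_fst.
- by rewrite -N0; exact: product_prob_fst.
- by move=> y /= Qy; exact: QN.
Qed.

Lemma ae_product_snd (Q : T2 -> Prop) :
  {ae m2, forall u, Q u} -> {ae m, forall y, Q y.2}.
Proof.
move=> [N [mN N0 QN]]; exists [set y | N y.2]; split.
- by rewrite -[X in measurable X]setTI; exact: measurable_snd.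
- by rewrite -N0; exact: product_prob_snd.
- by move=> y /= Qy; exact: QN.
Qed.

(** Tonelli is applied to the positive and the negative part separately. This covers integrands of
    any sign, such as [h] after an update that may leave [I]. *)
Lemma integral_product_fst (f : T1 -> \bar R) : measurable_fun [set: T1] f ->
  (\int[m]_y f y.1 = \int[m1]_u f u)%E.
Proof.
have ge0 (g : T1 -> \bar R) : measurable_fun [set: T1] g ->
    (forall u, 0 <= g u)%E -> (\int[m]_y g y.1 = \int[m1]_u g u)%E.
  move=> mg g0; rewrite fubini_tonelli1//; last exact: measurableT_comp.
  apply: eq_integral => u _; rewrite /fubini_F /= integral_cst//.
  by rewrite [X in (_ * X)%E]probability_setT mule1.
move=> mf; rewrite integralE [RHS]integralE; congr (_ - _)%E.
- rewrite -(ge0 (f^\+)%E)//; last exact: measurable_funepos.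
  by apply: eq_integral => y _; rewrite !funeposE.
- rewrite -(ge0 (f^\-)%E)//; last exact: measurable_funeneg.
  by apply: eq_integral => y _; rewrite !funenegE.
Qed.

End product_probability.

(** * Two-valued integrands and constant events under a probability *)

Section probability_lemmas.
Context (R : realType) (d : measure_display) (T : measurableType d).
Context (m : probability T R).

Lemma integral_prob_cst (r : \bar R) : (\int[m]_y r = r)%E.
Proof. by rewrite integral_cst// [X in (_ * X)%E]probability_setT mule1. Qed.

Lemma integral_prob_if (S : T -> bool) (a b : \bar R) :
  measurable [set y | S y] -> (0 <= a)%E -> (0 <= b)%E ->
  (\int[m]_y (if S y then a else b) =
   m [set y | S y] * a + (1 - m [set y | S y]) * b)%E.
Proof.
move=> mS a0 b0; rewrite -(setUv [set y | S y]) ge0_integral_setU//=.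
- rewrite (eq_integral (cst a)); last by move=> y; rewrite inE /= => ->.
  rewrite integral_cst// [X in (_ + X)%E](eq_integral (cst b)); last first.
    by move=> y; rewrite inE /= => /negP/negbTE ->.
  rewrite integral_cst; last exact: measurableC.
  rewrite [X in (_ + b * X)%E](@probability_setC _ _ _ m)//.
  by rewrite muleC [X in (_ + X)%E]muleC.
- exact: measurableC.
- rewrite setUv; apply: measurable_fun_ifT => //.
  by apply: (measurable_fun_bool true); rewrite setTI.
- by move=> y _; case: ifP.
- exact/disj_setPCl.
Qed.

Lemma prob_if_cst (S : T -> bool) (q1 q2 : Prop) : measurable [set y | S y] ->
  (m [set y | if S y then q1 else q2] =
   m [set y | S y] * (if `[< q1 >] then 1 else 0)%:E +
   (1 - m [set y | S y]) * (if `[< q2 >] then 1 else 0)%:E)%E.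
Proof.
move=> mS; have fS : (m [set y | S y] \is a fin_num)%E by exact: fin_num_measure.
case: asboolP => q1P; case: asboolP => q2P; rewrite ?mule0 ?mule1 ?adde0 ?add0e.
- rewrite addeC subeK// -(probability_setT m); congr (m _).
  by apply/seteqP; split=> y //= _; case: ifP.
- by congr (m _); apply/seteqP; split=> y /=; case: ifP.
- rewrite -probability_setC//; congr (m _).
  by apply/seteqP; split=> y /=; case: ifP => //= ? /(_ erefl).
- by rewrite -(measure0 m); congr (m _); apply/seteqP; split=> y //=; case: ifP.
Qed.

(** Serves to turn almost sure safety of a successor that does not depend on the noise into plain
    safety. *)
Lemma ae_cst (Q : Prop) : {ae m, forall y : T, Q} -> Q.
Proof.
move=> [N [mN N0 QN]]; apply: contrapT => nQ.
have : m [set: T] = 0%E.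
  by apply/eqP; rewrite eq_le measure_ge0 andbT -N0 le_measure ?inE// => y _; exact: QN.
by rewrite probability_setT => /eqP; rewrite onee_eq0.
Qed.

End probability_lemmas.

(** * One program step as a function of independent noise *)

Section transition.
Context (R : realType) (np nr : nat) (P : cfg R np nr).
Local Notation L := (label P).
Local Notation noise := (nr.-tuple R * measurableTypeR R)%type.

(* One step of the program as a deterministic function of a sample of the
   sampling variables and of a uniform variable that drives the coin flips. *)
Definition next_state (c : state P) (b : bool) (y : noise) : state P :=
  match kind c.1 with
  | KAssign F l' => (l', upd F c.2 y.1)
  | KBranch phi l1 l2 => (if ceval phi c.2 then l1 else l2, c.2)
  | KProb p l1 l2 => (if (y.2 : R) < p then l1 else l2, c.2)
  | KNondet l1 l2 => (if b then l1 else l2, c.2)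
  | KTick _ l' => (l', c.2)
  | KOut => c
  end.

Lemma measurable_next (d : measure_display) (T : measurableType d)
    (X : T -> mstate P) (b : T -> bool) (y : T -> noise) :
  measurable_fun [set: T] X -> measurable_fun [set: T] b ->
  measurable_fun [set: T] y ->
  measurable_fun [set: T] (fun t => next_state (X t) (b t) (y t) : mstate P).
Proof.
move=> mX mb my.
have mX1 l : measurable [set t | (X t).1 = l].
  by have := mX measurableT _ (measurable_label l); rewrite setTI.
have mX2 j : measurable_fun [set: T] (fun t => (X t).2 j).
  exact: measurableT_comp (@measurable_coord _ _ _ P j) mX.
have my1 i : measurable_fun [set: T] (fun t => tnth (y t).1 i).
  apply: (measurableT_comp (measurable_tnth i)).
  exact: (measurableT_comp measurable_fst).
have my2 : measurable_fun [set: T] (fun t => (y t).2).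
  exact: (measurableT_comp measurable_snd).
have mcst (l l' : L) : measurable [set _ : T | l = l'].
  have [ll'|ll'] := pselect (l = l').
    by rewrite (_ : [set _ | _] = setT)//; apply/seteqP; split.
  by rewrite (_ : [set _ | _] = set0)//; apply/seteqP; split.
have mlX l : measurable_fun [set: T] (fun t => (l, (X t).2) : mstate P).
  by apply: measurable_fun_state => //= l'; exact: mcst.
(* The state is rewritten as an explicit pair so that its label can be fixed; for each kind of label
   the step is then an explicit measurable map. *)
have -> : (fun t => next_state (X t) (b t) (y t) : mstate P) =
    fun t => next_state ((X t).1, (X t).2) (b t) (y t).
  by apply/funext => t; case: (X t).
apply: (@measurable_fun_finite_case _ T _ (mstate P) L (fun t => (X t).1)
  (fun l t => next_state (l, (X t).2) (b t) (y t))) => // l.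
rewrite /next_state /=; case: (kind l) => [F l'|phi l1 l2|p l1 l2|l1 l2|c l'|] //=.
- apply: measurable_fun_state => /= [l''|j].
    exact: mcst.
  apply: measurable_peval => i; rewrite /env.
  by case: (fintype.split i) => k; [exact: mX2|exact: my1].
- rewrite [X in measurable_fun _ X](_ : _ = fun t =>
    if ceval phi (X t).2 then (l1, (X t).2) else (l2, (X t).2)); last first.
    by apply/funext => t; case: ifP.
  by apply: measurable_fun_ifT => //; exact: measurable_ceval.
- rewrite [X in measurable_fun _ X](_ : _ = fun t =>
    if ((y t).2 : R) < p then (l1, (X t).2) else (l2, (X t).2)); last first.
    by apply/funext => t; case: ifP.
  by apply: measurable_fun_ifT => //; exact: measurable_fun_ltr.
- rewrite [X in measurable_fun _ X](_ : _ = fun t =>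
    if b t then (l1, (X t).2) else (l2, (X t).2)); last first.
    by apply/funext => t; case: ifP.
  exact: measurable_fun_ifT.
Qed.

Lemma step_next (mur : 'I_nr -> probability R R) (c : state P) (b : bool)
    (y : noise) :
  (forall j, in_support (mur j) (tnth y.1 j)) -> 0 <= (y.2 : R) < 1 ->
  step mur c (next_state c b y).
Proof.
move=> y1 /andP[y20 y21]; rewrite /step /next_state.
case: (kind c.1) => [F l'|phi l1 l2|p l1 l2|l1 l2|e l'|] //=.
- by exists y.1.
- case: (ltP (y.2 : R) p) => [yp|py]; [left|right]; split=> //.
    exact: (le_lt_trans y20 yp).
  exact: (le_lt_trans py y21).
- by case: b; [left|right].
Qed.

Context (mu : probability (nr.-tuple R) R).

Definition noise_law : probability noise R := (mu \x uniform01 R)%E.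

Lemma ae_step_next (mur : 'I_nr -> probability R R) (c : state P) (b : bool) :
  product_of mu mur -> {ae noise_law, forall y, step mur c (next_state c b y)}.
Proof.
move=> Hmu.
have h1 := @ae_product_fst _ _ _ _ _ mu (uniform01 R) _ (ae_product_support Hmu).
have h2 := @ae_product_snd _ _ _ _ _ mu (uniform01 R) _ (ae_uniform01 R).
by apply: filterS2 h1 h2 => y; exact: step_next.
Qed.

Lemma measurable_coin (p : R) : measurable [set y : noise | (y.2 : R) < p].
Proof.
rewrite -[X in measurable X]setTI.
by apply: measurable_fun_ltr => //; exact: measurable_snd.
Qed.

Lemma noise_law_coin (p : R) : 0 <= p <= 1 ->
  noise_law [set y | (y.2 : R) < p] = p%:E.
Proof.
move=> p01.
rewrite [LHS](@product_prob_snd _ _ _ _ _ mu (uniform01 R) [set x : R | x < p]).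
  exact: uniform01_lt.
by rewrite -[X in measurable X]setTI; exact: measurable_fun_ltr.
Qed.

(** An assignment reads only the first noise component and a coin flip only the second, so each
    reduces to a marginal; in all other cases the successor is constant and a box has mass 0 or
    1. *)
Lemma kernel_next (l : L) (w : 'I_np -> R) (b : bool)
    (A : set L * ('I_np -> set R)) : (forall j, measurable (A.2 j)) ->
  Defs.kernel mu l w b A = noise_law [set y | box_in A (next_state (l, w) b y)].
Proof.
move=> mA; rewrite /Defs.kernel /next_state /=.
have const (c : state P) : ind A c = noise_law [set y | box_in A c].
  rewrite /ind; case: asboolP => Ac.
    rewrite -(probability_setT noise_law); congr (noise_law _).
    by apply/seteqP; split.
  rewrite (_ : [set y | _] = set0) ?measure0//.
  by apply/seteqP; split.
case El : (kind l) => [F l'|phi l1 l2|p l1 l2|l1 l2|c l'|] //=.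
- rewrite [RHS](@product_prob_fst _ _ _ _ _ mu (uniform01 R)
    [set u | box_in A (l', upd F w u)])//.
  have : measurable_fun [set: nr.-tuple R] (fun u => (l', upd F w u) : mstate P).
    have -> : (fun u => (l', upd F w u) : mstate P) =
      fun u => next_state (l, w) b (u, 0) by rewrite /next_state /= El.
    by apply: measurable_next => //; exact: measurable_fun_pair.
  by move=> mf; rewrite -[X in measurable X]setTI; apply: mf => //; exact: measurable_box.
- have p01 := kind_prob El.
  have Sp := noise_law_coin p01.
  transitivity (noise_law [set y : noise |
      if (y.2 : R) < p then box_in A (l1, w) else box_in A (l2, w)]).
    by rewrite prob_if_cst ?Sp /ind ?EFinB//; exact: measurable_coin.
  by congr (noise_law _); apply/seteqP; split=> y /=; case: ifP.
Qed.

End transition.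

(** * Safe configurations *)

Section safety.
Context (R : realType) (np nr : nat) (P : cfg R np nr).
Context (mu : probability (nr.-tuple R) R).
Context (I : label P -> set ('I_np -> R)).
Local Notation L := (label P).
Local Notation nu := (noise_law mu).

Lemma measurable_polyhedra (S : set ('I_np -> R)) :
  finite_union_of_polyhedra S -> measurable [set c : mstate P | S c.2].
Proof.
case=> Ps ->.
have mlin (ab : ('I_np -> R) * R) : measurable [set c : mstate P | lin_sat ab c.2].
  have : measurable_fun [set: mstate P]
      (fun c : mstate P => \sum_(i < np) ab.1 i * c.2 i <= ab.2).
    apply: measurable_fun_ler => //; apply: measurable_sum => i.
    by apply: measurable_funM => //; exact: measurable_coord.
  by move=> /(_ measurableT [set true]); rewrite setTI; exact.
have mpoly cs : measurable [set c : mstate P | polyhedron_of cs c.2].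
  elim: cs => [|ab cs IH].
    by rewrite (_ : [set c | _] = setT)//; apply/seteqP; split=> c // _ ab [].
  rewrite (_ : [set c | _] = [set c : mstate P | lin_sat ab c.2] `&`
                             [set c : mstate P | polyhedron_of cs c.2]).
    exact: measurableI.
  apply/seteqP; split=> c /=.
    by move=> h; split=> [|ab' ?]; apply: h; [left|right].
  by move=> [h1 h2] ab' /= [<-//|]; exact: h2.
elim: Ps => [|cs Ps IH].
  by rewrite (_ : [set c | _] = set0)//; apply/seteqP; split=> c // [cs []].
rewrite (_ : [set c | _] = [set c : mstate P | polyhedron_of cs c.2] `|`
    [set c : mstate P | exists cs, List.In cs Ps /\ polyhedron_of cs c.2]).
  exact: measurableU.
apply/seteqP; split=> c /=.
  by move=> [cs' [[<-|inP] pc]]; [left|right; exists cs'].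
by move=> [pc|[cs' [? ?]]]; [exists cs; split=> //; left|exists cs'; split=> //; right].
Qed.

Context (I_polyhedra : forall l, finite_union_of_polyhedra (I l)).

Lemma measurable_invariant : measurable [set c : mstate P | I c.1 c.2].
Proof.
rewrite (_ : [set c | _] = \bigcup_(l in [set: L])
    ([set c : mstate P | c.1 = l] `&` [set c : mstate P | I l c.2])).
  apply: fin_bigcup_measurable => // l _; apply: measurableI.
    exact: measurable_label.
  exact: measurable_polyhedra.
by apply/seteqP; split=> c /=; [exists c.1|case=> l _ [/= <-]].
Qed.

(* [I] need not be inductive at unreachable configurations, and the reachable
   set is not known to be measurable; [safe] is a measurable, almost surely
   closed set in between. *)
Fixpoint safe_upto (n : nat) (c : state P) : Prop :=
  match n with
  | 0 => I c.1 c.2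
  | n.+1 => I c.1 c.2 /\
      forall b, nu [set y | ~ safe_upto n (next_state c b y)] = 0%E
  end.

Definition safe (c : state P) : Prop := forall n, safe_upto n c.

Lemma measurable_safe_upto (n : nat) :
  measurable [set c : mstate P | safe_upto n c].
Proof.
elim: n => [|n IH] /=; first exact: measurable_invariant.
rewrite (_ : [set c | _] = [set c : mstate P | I c.1 c.2] `&`
    \bigcap_(b in [set: bool]) [set c : mstate P |
      nu [set y | ~ safe_upto n (next_state c b y)] = 0%E]); last first.
  by apply/seteqP; split=> c /= [Ic h]; split=> // b *; exact: h.
apply: measurableI; first exact: measurable_invariant.
apply: fin_bigcap_measurable => // b _.
(* [A] collects the pairs of a state and a noise sample that lead out of level [n]. The mass of its
   section at [c] is a measurable function of [c], and the wanted set is where it vanishes. *)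
pose A := (fun z : mstate P * (nr.-tuple R * measurableTypeR R) =>
  next_state z.1 b z.2 : mstate P) @^-1` (~` [set c | safe_upto n c]).
have mA : measurable A.
  have mn := @measurable_next _ _ _ P _ _ fst (fun=> b) snd measurable_fst
    (@measurable_cst _ _ _ _ _ _) measurable_snd.
  by have := mn measurableT _ (measurableC IH); rewrite setTI.
have := @measurable_fun_xsection _ _ _ _ R nu A mA measurableT _
  (emeasurable_set1 0%E).
rewrite setTI (_ : _ @^-1` _ = [set c : mstate P |
  nu [set y | ~ safe_upto n (next_state c b y)] = 0%E])//.
apply/seteqP; split=> c /=; rewrite /xsection /=;
  by rewrite (_ : [set y | _ \in A] = [set y | ~ safe_upto n (next_state c b y)])//;
  apply/seteqP; split=> y /=; rewrite inE.
Qed.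

Lemma measurable_safe : measurable [set c : mstate P | safe c].
Proof.
rewrite (_ : [set c | _] = \bigcap_n [set c : mstate P | safe_upto n c]).
  by apply: bigcapT_measurable => n; exact: measurable_safe_upto.
by apply/seteqP; split=> c /= h n *; exact: h.
Qed.

Lemma measurable_next1 (c : state P) (b : bool) :
  measurable_fun [set: nr.-tuple R * measurableTypeR R]
    (fun y => next_state c b y : mstate P).
Proof. by apply: measurable_next => //; exact: measurable_id. Qed.

(** Level [n.+1] at [c] says that level [n] holds almost surely at the successor, and countably many
    levels can be combined. *)
Lemma ae_safe_next (c : state P) (b : bool) :
  safe c -> {ae nu, forall y, safe (next_state c b y)}.
Proof.
move=> sc; apply/ae_foralln => n.
have [_ /(_ b) s0] := sc n.+1; apply/negligibleP => //.
have := measurable_next1 c b measurableT (measurableC (measurable_safe_upto n)).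
by rewrite setTI.
Qed.

(** Induction on the level, for all reachable configurations at once: almost every noise sample
    yields a genuine [step], whose target is again reachable. *)
Lemma reachable_safe (mur : 'I_nr -> probability R R) (c0 c : state P) :
  product_of mu mur ->
  (forall c, reachable mur c0 c -> I c.1 c.2) -> reachable mur c0 c -> safe c.
Proof.
move=> Hmu HI + n; elim: n c => [|n IH] c c0c; first exact: HI.
split=> [|b]; first exact: HI.
apply/negligibleP.
  have := measurable_next1 c b measurableT (measurableC (measurable_safe_upto n)).
  by rewrite setTI.
apply: filterS (ae_step_next c b Hmu) => y cy.
by apply: IH; exact: reach_step cy.
Qed.

End safety.

(** * The potential and its drift inequality *)

Section drift.
Context (R : realType) (np nr : nat) (P : cfg R np nr).
Context (mu : probability (nr.-tuple R) R).
Context (I : label P -> set ('I_np -> R)).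
Context (d : nat) (h : label P -> ('I_np -> R) -> R).
Local Notation L := (label P).
Local Notation nu := (noise_law mu).
Local Notation safe := (safe mu I).

Definition potential (c : state P) : \bar R :=
  if `[< safe c >] then (h c.1 c.2)%:E else +oo%E.

(** The positive part keeps costs nonnegative at unsafe configurations too, where the sign
    hypothesis on costs gives no information. *)
Definition cost_pos (c : state P) : R := Num.max (step_cost c.1 c.2) 0.

Lemma measurable_step_cost :
  measurable_fun [set: mstate P] (fun c : mstate P => step_cost c.1 c.2).
Proof.
apply: (@measurable_fun_finite_case _ (mstate P) _ R L (fun c => c.1)
  (fun l c => step_cost l c.2)) => [l|l]; first exact: measurable_label.
rewrite /step_cost; case: (kind l) => // e l'.
by apply: measurable_peval => i; exact: measurable_coord.
Qed.

Lemma measurable_cost_pos :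
  measurable_fun [set: mstate P] (cost_pos : mstate P -> R).
Proof. by apply: measurable_maxr => //; exact: measurable_step_cost. Qed.

Context (I_polyhedra : forall l, finite_union_of_polyhedra (I l)).
Context (h_pucs : PUCS mu I d h).
Context (h_ge0 : forall l w, I l w -> 0 <= h l w).
Context (cost_ge0 : forall l c l', kind l = KTick c l' ->
  forall w, I l w -> 0 <= peval c w).

Lemma measurable_pucs :
  measurable_fun [set: mstate P] (fun c : mstate P => h c.1 c.2).
Proof.
have [h_poly _ _] := h_pucs.
apply: (@measurable_fun_finite_case _ (mstate P) _ R L (fun c => c.1)
  (fun l c => h l c.2)) => [l|l]; first exact: measurable_label.
have [e [_ he]] := h_poly l; under eq_fun do rewrite he.
by apply: measurable_peval => i; exact: measurable_coord.
Qed.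

Lemma measurable_potential :
  measurable_fun [set: mstate P] (potential : mstate P -> \bar R).
Proof.
apply: measurable_fun_ifT => //.
- apply: (measurable_fun_bool true); rewrite setTI.
  rewrite (_ : _ @^-1` _ = [set c : mstate P | safe c]).
    exact: measurable_safe.
  by apply/seteqP; split=> c /= /asboolP.
- by apply/measurable_EFinP; exact: measurable_pucs.
Qed.

Lemma potential_safe (c : state P) : safe c -> potential c = (h c.1 c.2)%:E.
Proof. by move=> sc; rewrite /potential; case: asboolP. Qed.

Lemma potential_ge0 (c : state P) : (0 <= potential c)%E.
Proof.
rewrite /potential; case: asboolP => [sc|_]; last exact: leey.
by rewrite lee_fin; apply: h_ge0; exact: (sc 0%N).
Qed.

Lemma cost_pos_safe (c : state P) : safe c -> cost_pos c = step_cost c.1 c.2.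
Proof.
move=> sc; apply/max_idPl; rewrite /step_cost.
by case E : (kind c.1) => [F l'|phi l1 l2|p l1 l2|l1 l2|e l'|] //;
  apply: (cost_ge0 E); exact: (sc 0%N).
Qed.

(** At an unsafe configuration the right side is infinite. At a safe one the successor is almost
    surely safe, so the potential there is [h] and the bound is condition (C3); at the terminal
    label the state is unchanged and the cost is zero. *)
Lemma potential_drift (c : state P) (b : bool) :
  (\int[nu]_y potential (next_state c b y) + (cost_pos c)%:E <= potential c)%E.
Proof.
have [sc|nsc] := pselect (safe c); last first.
  by rewrite [leRHS]/potential; case: asboolP => // _; exact: leey.
have Ic : I c.1 c.2 := sc 0%N.
have [_ _ h_pre] := h_pucs.
have snext := ae_safe_next I_polyhedra b sc.
rewrite (potential_safe sc) (cost_pos_safe sc) /step_cost.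
case E : (kind c.1) => [F l'|phi l1 l2|p l1 l2|l1 l2|e l'|].
all: have ne : kind c.1 <> KOut -> c.1 <> l_out P
  by move=> nk /(kind_out c.1); exact: nk.
all: rewrite E in ne.
- have {ne} := h_pre _ (ne ltac:(by [])) _ Ic; rewrite /pre E adde0 => h_c.
  apply: le_trans h_c.
  have mf : measurable_fun [set: nr.-tuple R * measurableTypeR R]
      (fun y => (h (next_state c b y).1 (next_state c b y).2)%:E).
    apply/measurable_EFinP.
    exact: measurableT_comp measurable_pucs (measurable_next1 c b).
  rewrite (ae_eq_integral
    (fun y => (h (next_state c b y).1 (next_state c b y).2)%:E))//.
  + rewrite -(@integral_product_fst _ _ _ _ _ mu (uniform01 R)
      (fun u => (h l' (upd F c.2 u))%:E)).
      by under eq_integral do rewrite /next_state E.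
    (* The sample 0 of the uniform variable is an arbitrary choice: an assignment does not read
       it. *)
    have := measurableT_comp mf (measurable_fun_pair
      (@measurable_id _ (nr.-tuple R) setT) (measurable_cst (0 : R))).
    by congr (measurable_fun _ _); apply/funext => u; rewrite /= /next_state E.
  + exact: measurableT_comp measurable_potential (measurable_next1 c b).
  + by apply: filterS snext => y sy _; exact: potential_safe.
- have {ne} := h_pre _ (ne ltac:(by [])) _ Ic; rewrite /pre E adde0.
  have {}snext : safe (if ceval phi c.2 then l1 else l2, c.2).
    by apply: (@ae_cst _ _ _ nu); apply: filterS snext => y; rewrite /next_state E.
  under eq_integral do rewrite /next_state E.
  by rewrite integral_prob_cst potential_safe//; case: ifP.
- have {ne} := h_pre _ (ne ltac:(by [])) _ Ic; rewrite /pre E adde0.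
  apply: le_trans.
  have p01 := kind_prob E; have Sp := noise_law_coin mu p01.
  have -> : (\int[nu]_y potential (next_state c b y) =
      \int[nu]_y (if ((y.2 : R) < p)%R then potential (l1, c.2)
                  else potential (l2, c.2)))%E.
    by apply: eq_integral => y _; rewrite /next_state E; case: ifP.
  rewrite integral_prob_if; [|exact: measurable_coin|exact: potential_ge0..].
  rewrite Sp EFinD !EFinM -EFinB.
  (* A branch of positive probability must be safe, since otherwise an event of positive mass would
     lead to unsafe successors. A branch of probability zero may have infinite potential, but its
     term vanishes because [0 * +oo = 0]. *)
  have s1 : p != 0 -> safe (l1, c.2).
    apply: contra_neqP => ns1; apply: EFin_inj; rewrite -Sp.
    apply/negligibleP; first exact: measurable_coin.
    apply: negligibleS snext => y /= yp; rewrite /next_state E yp.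
    exact: ns1.
  have s2 : p != 1 -> safe (l2, c.2).
    apply: contra_neqP => ns2.
    have : nu (~` [set y | (y.2 : R) < p]) = 0%E.
      apply/negligibleP; first by apply: measurableC; exact: measurable_coin.
      apply: negligibleS snext => y /= /negP/negbTE yp.
      by rewrite /next_state E yp; exact: ns2.
    rewrite [X in X = _ -> _](@probability_setC _ _ _ nu); last exact: measurable_coin.
    by rewrite Sp -EFinB => -[] /eqP; rewrite subr_eq0 => /eqP.
  rewrite leeD//.
    have [->|/s1 ?] := eqVneq p 0; first by rewrite !mul0e.
    by rewrite potential_safe.
  have [->|/s2 ?] := eqVneq p 1; first by rewrite subrr !mul0e.
  by rewrite potential_safe.
- have {ne} := h_pre _ (ne ltac:(by [])) _ Ic; rewrite /pre E adde0.
  apply: le_trans.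
  have {}snext : safe (if b then l1 else l2, c.2).
    by apply: (@ae_cst _ _ _ nu); apply: filterS snext => y; rewrite /next_state E.
  under eq_integral do rewrite /next_state E.
  rewrite integral_prob_cst potential_safe// lee_fin le_max.
  by case: b {snext}; rewrite lexx ?orbT.
- have {ne} := h_pre _ (ne ltac:(by [])) _ Ic; rewrite /pre E.
  apply: le_trans.
  have {}snext : safe (l', c.2).
    by apply: (@ae_cst _ _ _ nu); apply: filterS snext => y; rewrite /next_state E.
  under eq_integral do rewrite /next_state E.
  by rewrite integral_prob_cst potential_safe// -EFinD addrC.
- under eq_integral do rewrite /next_state E.
  by rewrite integral_prob_cst potential_safe// adde0.
Qed.

End drift.

(** * Comparison of integrals *)

Import HBNNSimple.

(* Stated for a non-measurable [f]: [total_cost] is the limit of a series that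
   need not converge outside the safe runs. *)
Lemma integral_le_ae (R : realType) (d : measure_display) (T : measurableType d)
    (m : {measure set T -> \bar R}) (f F : T -> \bar R) :
  measurable_fun [set: T] F -> (forall x, 0 <= F x)%E ->
  {ae m, forall x, f x = F x} -> (\int[m]_x f x <= \int[m]_x F x)%E.
Proof.
move=> mF F0 fF; rewrite integralE.
apply: (@le_trans _ _ (\int[m]_x f^\+ x)%E).
  by rewrite -[leRHS]sube0 leeB// integral_ge0.
(* The integral of [f^\+] is a supremum over nonnegative simple functions below it. Each of these is
   measurable and almost everywhere below [F]. *)
rewrite ge0_integralTE//; apply: ub_ereal_sup => _ [s sf <-].
rewrite -integralT_nnsfun; apply: ae_ge0_le_integral => //.
- by move=> x _; rewrite lee_fin.
- exact/measurable_EFinP.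
- apply: filterS fF => x fx _; apply: (le_trans (sf x)).
  by rewrite funeposE fx ge_max lexx F0.
Qed.

(** * Expectations determined by probabilities of boxes *)

Section state_law.
Context (R : realType) (np nr : nat) (P : cfg R np nr).

(** Both integrals are integrals of [g] against image measures. These are finite and agree on the
    pi-system of boxes, hence on all measurable sets. *)
Lemma expectation_state (d1 d2 : measure_display) (T1 : measurableType d1)
    (T2 : measurableType d2) (m1 : probability T1 R)
    (m2 : {measure set T2 -> \bar R})
    (f1 : T1 -> mstate P) (f2 : T2 -> mstate P) (g : mstate P -> \bar R) :
  measurable_fun [set: T1] f1 -> measurable_fun [set: T2] f2 ->
  measurable_fun [set: mstate P] g -> (forall c, 0 <= g c)%E ->
  (forall A : set (label P) * ('I_np -> set R), (forall j, measurable (A.2 j)) ->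
     m1 [set t | box_in A (f1 t)] = m2 [set t | box_in A (f2 t)]) ->
  (\int[m1]_t g (f1 t) = \int[m2]_t g (f2 t))%E.
Proof.
move=> mf1 mf2 mg g0 m12.
have push d (T : measurableType d) (m : {measure set T -> \bar R}) f :
    measurable_fun [set: T] f ->
    (\int[m]_t g (f t) = \int[pushforward m f]_c g c)%E.
  by move=> mf; rewrite (ge0_integral_pushforward mf).
rewrite (push _ _ m1 _ mf1) (push _ _ m2 _ mf2).
pose p1 : {measure set (mstate P) -> \bar R} :=
  pushforward m1 f1.
pose p2 : {measure set (mstate P) -> \bar R} :=
  pushforward m2 f2.
change (\int[p1 mf1]_c g c = \int[p2 mf2]_c g c)%E.
apply: eq_measure_integral => S mS _.
apply: (@measure_unique _ _ (mstate P) (@boxes _ _ _ P) (fun=> setT)) => //.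
- exact: setI_closed_boxes.
- by move=> _; exact: boxesT.
- by rewrite bigcup_const//; exists 0%N.
- by move=> _ [A mA ->]; exact: m12.
- by move=> _; rewrite /p1 /= /pushforward /= preimage_setT (probability_setT m1) ltry.
Qed.

End state_law.

(** * One-step expectations along a run *)

Section process.
Context (R : realType) (np nr : nat) (P : cfg R np nr).
Context (mu : probability (nr.-tuple R) R) (v : 'I_np -> R).
Context (sigma : seq (label P * ('I_np -> R)) -> bool).
Context (dO : measure_display) (Omega : measurableType dO).
Context (Pr : probability Omega R).
Context (lab : nat -> Omega -> label P) (val : nat -> Omega -> 'I_np -> R).
Context (run : run_process mu sigma v Pr lab val).
Local Notation nu := (noise_law mu).

Definition conf (n : nat) (om : Omega) : mstate P := (lab n om, val n om).

Lemma measurable_conf (n : nat) : measurable_fun [set: Omega] (conf n).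
Proof.
case: run => mlab mval _ _ _.
by apply: measurable_fun_state => [l|j]; [exact: mlab|exact: mval].
Qed.

Local Notation sched n om := (sigma (hist lab val n om)).

Lemma measurable_sched (n : nat) :
  measurable_fun [set: Omega] (fun om => sched n om).
Proof.
case: run => _ _ ms _ _.
by apply: (measurable_fun_bool true); rewrite setTI; exact: ms.
Qed.

Lemma measurable_next_conf (n : nat) :
  measurable_fun [set: Omega * (nr.-tuple R * measurableTypeR R)]
    (fun z => next_state (conf n z.1) (sched n z.1) z.2 : mstate P).
Proof.
apply: measurable_next; last exact: measurable_snd.
  exact: measurableT_comp (measurable_conf n) measurable_fst.
exact: measurableT_comp (measurable_sched n) measurable_fst.
Qed.

(** The next configuration of the run is not itself a function of the noise; only its law is
    compared with that of a simulated successor on [Omega] times the noise space. The scheduler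
    still sees the whole history through [z.1]. *)
Lemma next_conf_law (n : nat) (A : set (label P) * ('I_np -> set R)) :
  (forall j, measurable (A.2 j)) ->
  Pr [set om | box_in A (conf n.+1 om)] =
  (Pr \x nu)%E [set z | box_in A (next_state (conf n z.1) (sched n z.1) z.2)].
Proof.
move=> mA; case: run => _ _ _ _ trans.
(* Unconstrained boxes at times up to [n] reduce the prescribed joint probability to the marginal at
   time [n.+1]. *)
pose As i := if i == n.+1 then A else (setT, fun=> setT).
have mAs i j : measurable ((As i).2 j) by rewrite /As; case: eqP => [_|_ //=]; exact: mA.
have := trans n As mAs.
rewrite (_ : [set om | forall i, _] = [set om | box_in A (conf n.+1 om)]); last first.
  apply/seteqP; split=> om /=.
    by move=> /(_ n.+1 (leqnn _)); rewrite /As eqxx.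
  by move=> Aom i _; rewrite /As; case: eqP => [->//|_]; split.
move=> ->; rewrite /product_measure1; apply: eq_integral => om _.
rewrite /As eqxx; case: asboolP => [_|[]]; last first.
  by move=> i; case: eqP => [->|_ _]; [rewrite ltnn|split].
rewrite mul1e kernel_next//=; congr (nu _).
by apply/seteqP; split=> y /=; rewrite /xsection /= inE.
Qed.

(** Equality of laws followed by Tonelli; this takes the place of conditioning on the history up to
    time [n]. *)
Lemma expectation_conf_succ (n : nat) (g : mstate P -> \bar R) :
  measurable_fun [set: mstate P] g -> (forall c, 0 <= g c)%E ->
  (\int[Pr]_om g (conf n.+1 om) =
   \int[Pr]_om \int[nu]_y g (next_state (conf n om) (sched n om) y))%E.
Proof.
move=> mg g0.
rewrite (@expectation_state _ _ _ P _ _ _ _ Pr (Pr \x nu)%E _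
  (fun z => next_state (conf n z.1) (sched n z.1) z.2))//.
- rewrite fubini_tonelli1//.
  exact: measurableT_comp mg (measurable_next_conf n).
- exact: measurable_conf.
- exact: measurable_next_conf.
- by move=> A mA; exact: next_conf_law.
Qed.

Lemma expectation_conf0 (g : mstate P -> \bar R) :
  measurable_fun [set: mstate P] g -> (forall c, 0 <= g c)%E ->
  (\int[Pr]_om g (conf 0 om) = g (l_in P, v))%E.
Proof.
move=> mg g0; case: run => _ _ _ init _.
rewrite (@expectation_state _ _ _ P _ _ _ _ Pr Pr _ (fun=> (l_in P, v)))//.
- exact: integral_prob_cst.
- exact: measurable_conf.
- move=> A mA; rewrite init// /ind; case: asboolP => Av.
    rewrite (_ : [set _ | _] = setT).
      by rewrite [RHS](@probability_setT _ _ _ Pr).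
    by apply/seteqP; split.
  by rewrite (_ : [set _ | _] = set0) ?measure0//; apply/seteqP; split.
Qed.

(** * Telescoping the expected potential *)

Context (I : label P -> set ('I_np -> R)).
Context (d : nat) (h : label P -> ('I_np -> R) -> R).
Context (I_polyhedra : forall l, finite_union_of_polyhedra (I l)).
Context (h_pucs : PUCS mu I d h).
Context (h_ge0 : forall l w, I l w -> 0 <= h l w).
Context (cost_ge0 : forall l c l', kind l = KTick c l' ->
  forall w, I l w -> 0 <= peval c w).
Context (v_safe : safe mu I (l_in P, v)).

Lemma measurable_cost_conf (n : nat) :
  measurable_fun [set: Omega] (fun om => (cost_pos (conf n om))%:E).
Proof.
apply/measurable_EFinP.
exact: measurableT_comp (@measurable_cost_pos _ _ _ P) (measurable_conf n).
Qed.

Lemma cost_pos_ge0 (c : state P) : (0 <= (cost_pos c)%:E)%E.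
Proof. by rewrite lee_fin le_max lexx orbT. Qed.

Let measurable_pot := measurable_potential I_polyhedra h_pucs.
Let pot_ge0 := potential_ge0 mu h_ge0.

Lemma expected_potential_succ (n : nat) :
  (\int[Pr]_om potential mu I h (conf n.+1 om) +
   \int[Pr]_om (cost_pos (conf n om))%:E <=
   \int[Pr]_om potential mu I h (conf n om))%E.
Proof.
rewrite expectation_conf_succ//.
have mint : measurable_fun [set: Omega] (fun om => (\int[nu]_y
    potential mu I h (next_state (conf n om) (sched n om) y))%E).
  apply: (@measurable_fun_fubini_tonelli_F _ _ _ _ R nu (fun z =>
    potential mu I h (next_state (conf n z.1) (sched n z.1) z.2))) => //.
  exact: measurableT_comp measurable_pot (measurable_next_conf n).
have int0 om : (0 <= \int[nu]_y
    potential mu I h (next_state (conf n om) (sched n om) y))%E.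
  exact: integral_ge0.
rewrite -ge0_integralD//; last 2 first.
- by move=> om _; exact: cost_pos_ge0.
- exact: measurable_cost_conf.
apply: ge0_le_integral => //.
- by move=> om _; rewrite adde_ge0// cost_pos_ge0.
- by apply: emeasurable_funD => //; exact: measurable_cost_conf.
- exact: measurableT_comp measurable_pot (measurable_conf n).
- by move=> om _; exact: (potential_drift I_polyhedra h_pucs).
Qed.

(** Potential and accumulated costs stay on the same side, so the telescoping never subtracts
    extended reals. *)
Lemma expected_potential_le (n : nat) :
  (\int[Pr]_om potential mu I h (conf n om) +
   \sum_(0 <= m < n) \int[Pr]_om (cost_pos (conf m om))%:E <=
   (h (l_in P) v)%:E)%E.
Proof.
elim: n => [|n IH].
  by rewrite big_geq// adde0 expectation_conf0// potential_safe.
apply: le_trans IH; rewrite big_nat_recr//= addeA.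
by rewrite addeAC leeD2r// expected_potential_succ.
Qed.

(** The expected potential at time [n] is at most the real [h (l_in P) v], so the potential is
    almost surely finite, whereas it is [+oo] at unsafe configurations. *)
Lemma ae_safe_conf : {ae Pr, forall om, forall n, safe mu I (conf n om)}.
Proof.
apply/ae_foralln => n.
have mpn : measurable_fun [set: Omega] (fun om => potential mu I h (conf n om)).
  exact: measurableT_comp measurable_pot (measurable_conf n).
have : Pr.-integrable [set: Omega] (fun om => potential mu I h (conf n om)).
  apply/integrableP; split=> //.
  under eq_integral do rewrite gee0_abs//.
  apply: (@le_lt_trans _ _ (h (l_in P) v)%:E); last exact: ltry.
  apply: le_trans (expected_potential_le n); rewrite leeDl//.
  by apply: sume_ge0 => m _; apply: integral_ge0 => om _; exact: cost_pos_ge0.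
move=> /(integrable_ae measurableT); apply: filterS => om /(_ Logic.I).
by rewrite /potential; case: asboolP.
Qed.

Lemma expected_total_cost_le :
  (\int[Pr]_om total_cost lab val om <= (h (l_in P) v)%:E)%E.
Proof.
have c0 n om : (0 <= (cost_pos (conf n om))%:E)%E by exact: cost_pos_ge0.
(* On almost every run all configurations are safe, and there the costs coincide with their positive
   parts. *)
apply: (@le_trans _ _ (\int[Pr]_om \sum_(n <oo) (cost_pos (conf n om))%:E)%E).
  apply: integral_le_ae.
  - by apply: ge0_emeasurable_sum => // k _; exact: measurable_cost_conf.
  - by move=> om; exact: nneseries_ge0.
  - apply: filterS ae_safe_conf => om som; rewrite /total_cost.
    apply: eq_eseriesr => n _.
    by rewrite (cost_pos_safe cost_ge0 (som n)).
(* Monotone convergence moves the expectation inside the series; each partial sum is then bounded by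
   dropping the nonnegative expected potential. *)
rewrite integral_nneseries//; last by move=> n; exact: measurable_cost_conf.
apply: lime_le.
  by apply: is_cvg_nneseries => n _ _; exact: integral_ge0.
near=> n; apply: le_trans (expected_potential_le n).
by rewrite leeDr// integral_ge0.
Unshelve. all: by end_near. Qed.

End process.

(** * Runs started from a valuation in the invariant *)

Theorem theorem6p9 (R : realType) (np nr : nat) (P : cfg R np nr)
    (mur : 'I_nr -> probability R R) (mu : probability (nr.-tuple R) R)
    (Hmu : product_of mu mur)
    (I : label P -> set ('I_np -> R)) (HI : linear_invariant mur I)
    (d : nat) (h : label P -> ('I_np -> R) -> R) (Hh : PUCS mu I d h)
    (Hfin : pre_finite mu I h)
    (Hh0 : forall l w, I l w -> 0 <= h l w)
    (Hcost : forall l c l', kind l = KTick c l' -> forall w, I l w -> 0 <= peval c w) :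
  forall v : 'I_np -> R, I (l_in P) v ->
  forall (sigma : seq (label P * ('I_np -> R)) -> bool)
    (dO : measure_display) (Omega : measurableType dO) (Pr : probability Omega R)
    (lab : nat -> Omega -> label P) (val : nat -> Omega -> 'I_np -> R),
  run_process mu sigma v Pr lab val ->
  (\int[Pr]_om total_cost lab val om <= (h (l_in P) v)%:E)%E.
Proof.
move=> v Iv sigma dO Omega Pr lab val run; have [I_poly I_inv] := HI.
apply: (expected_total_cost_le run I_poly Hh Hh0 Hcost).
(* The initial configuration is reachable from itself, and every configuration reachable from it
   lies in [I], so it is safe. *)
apply: (reachable_safe I_poly Hmu); last exact: reach_refl.
exact: I_inv.
Qed.
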